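(* Let $G$ be a locally compact group and let $\pi$ be an isometric representation of $G$ on a Banach space $E\in\mathcal{O}$. Assume that there exists a sequence of elements $\{g_n\}\subset G$, $g_n\to\infty$, such that, with limits taken in the weak operator topology on $B(E)$, $$\lim_{n}\pi_{g_n}=\lim_n \pi_{g_n^{-1}}=P^{\pi}.$$ Then $E_\pi$ is Birkhoff-James orthogonal to $E^\pi$ and $\Vert I-P^\pi\Vert=1$.
   Context: $\mathcal{O}$ denotes the class of uniformly convex, uniformly smooth Banach spaces with the Opial property. A Banach space $E$ has the Opial property if for every weakly convergent sequence $\{x_n\}\subseteq E$ with weak limit $x_0\in E$ the inequality $\liminf\Vert x_n-x_0\Vert<\liminf\Vert x_n-y\Vert$ holds for every $y\neq x_0$. Spaces in $\mathcal{O}$ are in particular reflexive. $B(E)$ is the space of bounded linear operators on $E$, and $I$ is the identity operator. An isometric representation $\pi$ of $G$ on $E$ is a homomorphism $g\mapsto\pi_g$ into the invertible linear isometries of $E$, assumed continuous in the strong operator topology (for each $v\in E$ the map $g\mapsto\pi_g v$ is norm continuous). The dual space $E^*$ carries the isometric representation $\overline{\pi}_g=(\pi_g^* )^{-1}$. Let $E^\pi=\{v\in E:\pi_g v=v\text{ for all }g\in G\}$, define $(E^* )^{\overline\pi}$ analogously, and let $E_\pi=\{v\in E:\langle v,w\rangle=0\text{ for all }w\in (E^* )^{\overline\pi}\}$ be the annihilator of $(E^* )^{\overline\pi}$. For reflexive $E$ there is a $\pi$-invariant direct sum decomposition $E=E^\pi\oplus E_\pi$; $P^\pi$ is the projection of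 $E$ onto $E^\pi$ along $E_\pi$. $g_n\to\infty$ means that for every compact subset of $G$, $g_n$ lies outside it for all sufficiently large $n$. A vector $0\ne v\in E$ is Birkhoff-James orthogonal to $0\neq w\in E$ if $\Vert v\Vert\le\Vert v+\lambda w\Vert$ for every $\lambda\in\mathbb{R}$. A subspace $V_1$ of $E$ is Birkhoff-James orthogonal to a subspace $V_2$ of $E$ if $v_1$ is Birkhoff-James orthogonal to $v_2$ for all (nonzero) $v_1\in V_1$ and $v_2\in V_2$.
   Formalization: The equality ‖I − P^π‖ = 1 is claimed only when E_π ≠ {0}; if E_π = {0} (e.g. a trivial representation of the integers) then P^π = I and ‖I − P^π‖ = 0. *)

(* Defs.v *)
From HB Require Import structures.
From mathcomp Require Import all_boot all_order all_algebra.
From mathcomp Require Import all_classical all_reals all_analysis.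

Set Implicit Arguments.
Unset Strict Implicit.
Unset Printing Implicit Defensive.

Import Order.TTheory GRing.Theory Num.Theory.
Import numFieldNormedType.Exports.

Local Open Scope classical_set_scope.
Local Open Scope ring_scope.

HB.mixin Record isTopologicalGroup G of Topological G & Group G := {
  mulg_continuous : continuous (fun xy : G * G => (xy.1 * xy.2)%g) ;
  invg_continuous : continuous (fun x : G => (x^-1)%g)
}.

#[short(type="topologicalGroupType")]
HB.structure Definition TopologicalGroup :=
  { G of Topological G & Group G & isTopologicalGroup G }.

Definition tends_to_infinity (G : topologicalType) (g : nat -> G) :=
  forall K : set G, compact K -> \forall n \near \oo, ~ K (g n).

Section Banach.
Context {R : realType} (E : completeNormedModType R).

Definition uniformly_convex :=
  forall e : R, 0 < e -> exists2 d : R, 0 < d &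
    forall x y : E, `|x| = 1 -> `|y| = 1 -> e <= `|x - y| ->
      `|2^-1 *: (x + y)| <= 1 - d.

(* The modulus of smoothness
   rho t = sup {(`|x + y| + `|x - y|) / 2 - 1 : `|x| = 1, `|y| = t}
   satisfies rho t / t --> 0 as t --> 0+. *)
Definition uniformly_smooth :=
  forall e : R, 0 < e -> exists2 d : R, 0 < d &
    forall x y : E, `|x| = 1 -> `|y| <= d ->
      (`|x + y| + `|x - y|) / 2 - 1 <= e * `|y|.

Definition dual : set (E -> R) :=
  [set f : E -> R | scalar f /\ continuous f].

Definition weak_cvg (x : nat -> E) (x0 : E) :=
  forall f, dual f -> f (x n) @[n --> \oo] --> f x0.

(* The limits inferior are taken in the extended reals, so they always exist. *)
Definition Opial_property :=
  forall (x : nat -> E) (x0 : E), weak_cvg x x0 ->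
  forall y : E, y != x0 ->
    (limn_einf (fun n => `|x n - x0|%:E) <
     limn_einf (fun n => `|x n - y|%:E))%E.

Definition class_O :=
  [/\ uniformly_convex, uniformly_smooth & Opial_property].

End Banach.

Section Operators.
Context {R : realType} {E : completeNormedModType R}.

(* Convergence in the weak operator topology, which is generated by the
   seminorms T |-> `|f (T v)| for v in E and f in the dual of E. *)
Definition wot_cvg (T : nat -> E -> E) (L : E -> E) :=
  forall (v : E) f, dual f -> f (T n v) @[n --> \oo] --> f (L v).

(* Extended-real valued: +oo when T is unbounded on the unit ball. *)
Definition opnorm (T : E -> E) : \bar R :=
  ereal_sup [set `|T v|%:E | v in [set v : E | `|v| <= 1]].

Definition BJ_orthogonal (v w : E) :=
  forall l : R, `|v| <= `|v + l *: w|.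

Definition BJ_orthogonal_sub (V1 V2 : set E) :=
  forall v1 v2, V1 v1 -> v1 != 0 -> V2 v2 -> v2 != 0 -> BJ_orthogonal v1 v2.

End Operators.

(* Each [rep g] is invertible, with inverse [rep g^-1], by [rep1] and [repM]. *)
Record isometric_rep (R : realType) (G : topologicalGroupType)
    (E : completeNormedModType R) := IsometricRep {
  rep :> G -> {linear E -> E} ;
  rep_isometry : forall g v, `|rep g v| = `|v| ;
  rep1 : forall v, rep 1%g v = v ;
  repM : forall g h v, rep (g * h)%g v = rep g (rep h v) ;
  rep_continuous : forall v, continuous (fun g => rep g v)
}.

Section Representations.
Context {R : realType} {G : topologicalGroupType}
  {E : completeNormedModType R}.
Variable pi : isometric_rep G E.

Definition invariants : set E := [set v | forall g, pi g v = v].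

(* The adjoint of [pi g] is f |-> f \o pi g, hence its inverse is
   f |-> f \o pi g^-1. *)
Definition dual_rep (g : G) (f : E -> R) : E -> R := f \o pi (g^-1)%g.

Definition dual_invariants : set (E -> R) :=
  [set f | dual f /\ forall g, dual_rep g f = f].

Definition coinvariants : set E :=
  [set v | forall f, dual_invariants f -> f v = 0].

(* The projection onto [invariants] along [coinvariants]: v is mapped to its
   component p in the decomposition v = p + (v - p). The default value 0 of
   [xget] is irrelevant when E is the direct sum of the two subspaces, which
   holds for every reflexive E. *)
Definition proj_invariants (v : E) : E :=
  xget 0 [set p | invariants p /\ coinvariants (v - p)].

End Representations.

(* Main.v *)
Require Import Defs.
From HB Require Import structures.
From mathcomp Require Import all_boot all_order all_algebra.
From mathcomp Require Import all_classical all_reals all_analysis.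

Import Order.TTheory GRing.Theory Num.Theory.
Import numFieldNormedType.Exports.

Local Open Scope classical_set_scope.
Local Open Scope ring_scope.

(** Let v lie in [coinvariants pi] and w in [invariants pi].  The vectors
    [pi (g n) v] converge weakly to the projection of v, that is to 0, so the
    Opial property says that no vector is asymptotically closer to them than 0
    is.  Since [pi (g n)] is isometric and fixes w, the distance from
    [pi (g n) v] to [- l *: w] is the constant [`|v + l *: w|], while its
    distance to 0 is the constant [`|v|]; hence [`|v| <= `|v + l *: w|], which
    is [norm_coinvariants_le].  Taking l = 1 and v = u - p, w = p for the
    decomposition of a vector u gives the norm bound [`|u - p| <= `|u|], and
    equality holds on [coinvariants pi], where the projection vanishes.

    The projection of v in [coinvariants pi] is an invariant vector p with
    v - p, hence p, in [coinvariants pi]; it vanishes because the two subspaces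
    meet only in 0 ([invariants_coinvariants0]).  Indeed the choice of a
    component p gives one and the same vector for all v in [coinvariants pi],
    whereas on invariant vectors the projection is a weak limit of the identity.
    So every bounded functional is constant, hence zero, on the intersection;
    and by the Opial property of constant sequences bounded functionals separate
    points ([Opial_dual_separates]). *)

Lemma dual0 (R : realType) (E : completeNormedModType R) (f : E -> R) :
  dual f -> f 0 = 0.
Proof.
by move=> [lf _]; have := lf (-1) 0 0; rewrite scaler0 addr0 mulN1r addNr.
Qed.

(** A vector x killed by all bounded functionals would make the constant
    sequence x converge weakly to 0, although it is closer to x than to 0. *)
Lemma Opial_dual_separates (R : realType) (E : completeNormedModType R)
    (x : E) :
  Opial_property E -> (forall f, dual f -> f x = 0) -> x = 0.
Proof.
move=> opial fx0; apply/eqP/negP => /negP x0.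
have cvgx : weak_cvg (fun=> x) 0.
  by move=> f df; rewrite dual0 // fx0 //; exact: cvg_cst.
have := opial _ _ cvgx x x0.
rewrite !(cvg_limn_einf_sup (cvg_cst _)).1 subr0 subrr normr0 lte_fin.
by rewrite normr_lt0.
Qed.

Section Subspaces.
Context (R : realType) (G : topologicalGroupType)
  (E : completeNormedModType R) (pi : isometric_rep G E).

Lemma invariants0 : invariants pi 0.
Proof. by move=> h; rewrite linear0. Qed.

Lemma invariantsZ (a : R) (v : E) : invariants pi v -> invariants pi (a *: v).
Proof. by move=> iv h; rewrite linearZ /= iv. Qed.

Lemma coinvariants_linear (a : R) (u v : E) :
  coinvariants pi u -> coinvariants pi v -> coinvariants pi (a *: u + v).
Proof.
move=> cu cv f df; have [[lf _] _] := df.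
by rewrite lf cu // cv // addr0 mulr0.
Qed.

Lemma coinvariants0 : coinvariants pi 0.
Proof. by move=> f [df _]; exact: dual0. Qed.

Lemma coinvariantsB (u v : E) :
  coinvariants pi u -> coinvariants pi v -> coinvariants pi (u - v).
Proof. by move=> cu cv; rewrite addrC -scaleN1r; exact: coinvariants_linear. Qed.

Lemma coinvariantsZ (a : R) (v : E) :
  coinvariants pi v -> coinvariants pi (a *: v).
Proof.
by move=> cv; rewrite -[_ *: _]addr0; apply: coinvariants_linear => //;
  exact: coinvariants0.
Qed.

(** The conditions defining the projections of w and of 0 are equivalent,
    and [xget] depends only on the set from which it chooses. *)
Lemma proj_coinvariants_const (w : E) :
  coinvariants pi w -> proj_invariants pi w = proj_invariants pi 0.
Proof.
move=> cw; rewrite /proj_invariants; congr xget.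
apply/seteqP; split => q /= [iq cq]; split=> //.
- have -> : 0 - q = (w - q) - w by rewrite addrAC subrr.
  exact: coinvariantsB.
- have -> : w - q = (0 - q) - (0 - w) by rewrite !sub0r opprK addrC.
  by apply: coinvariantsB => //; apply: coinvariantsB => //; exact: coinvariants0.
Qed.

End Subspaces.

Section WeakLimit.
Context (R : realType) (G : topologicalGroupType)
  (E : completeNormedModType R) (pi : isometric_rep G E) (g : nat -> G).
Context (opial : Opial_property E)
  (cvg_pi : wot_cvg (fun n => pi (g n)) (proj_invariants pi)).

Lemma dual_proj_invariants (v : E) f :
  invariants pi v -> dual f -> f (proj_invariants pi v) = f v.
Proof.
move=> iv df; have := cvg_pi v f df.
under eq_fun do rewrite iv.
by move=> /cvg_lim <- //; rewrite lim_cst.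
Qed.

Lemma invariants_coinvariants0 (w : E) :
  invariants pi w -> coinvariants pi w -> w = 0.
Proof.
move=> iw cw; apply: Opial_dual_separates => // f df.
rewrite -(dual_proj_invariants _ _ iw df) proj_coinvariants_const //.
by rewrite (dual_proj_invariants _ _ (invariants0 _ _ _ pi) df) dual0.
Qed.

Lemma proj_coinvariants (v : E) :
  coinvariants pi v -> proj_invariants pi v = 0.
Proof.
move=> cv; rewrite /proj_invariants; case: xgetP => // q _ [iq cq].
apply: invariants_coinvariants0 => //.
by rewrite -(subKr v q); exact: coinvariantsB.
Qed.

Lemma norm_coinvariants_le (v w : E) :
  coinvariants pi v -> invariants pi w -> `|v| <= `|v + w|.
Proof.
move=> cv iw; have [->|w0] := eqVneq w 0; first by rewrite addr0.
have cvgv : weak_cvg (fun n => pi (g n) v) 0.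
  by move=> f df; rewrite -(proj_coinvariants _ cv); exact: cvg_pi.
have := opial _ _ cvgv (- w); rewrite oppr_eq0 => /(_ w0).
under eq_fun do rewrite subr0 rep_isometry.
under [X in (_ < limn_einf X)%E]eq_fun => n.
  rewrite opprK -{1}(iw (g n)) -linearD rep_isometry.
  over.
by rewrite !(cvg_limn_einf_sup (cvg_cst _)).1 lte_fin => /ltW.
Qed.

(** A decomposition of v has Birkhoff-James orthogonal components, which bounds
    the first one; where v has none, [proj_invariants] takes its default value
    0 and the bound is an equality. *)
Lemma norm_sub_proj_le (v : E) : `|v - proj_invariants pi v| <= `|v|.
Proof.
rewrite /proj_invariants; case: xgetP => [p _ [ip cvp]|_].
  by rewrite -[leRHS](congr1 _ (subrK p v)); exact: norm_coinvariants_le.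
by rewrite subr0.
Qed.

Lemma opnorm_sub_proj : coinvariants pi != [set 0] ->
  opnorm (fun v => v - proj_invariants pi v) = 1%:E.
Proof.
move=> nt; have [v cv v0] : exists2 v, coinvariants pi v & v != 0.
  apply: contrapT => nov; move/eqP: nt; apply.
  apply/seteqP; split => [v cv /=|_ ->]; last exact: coinvariants0.
  by apply/eqP/negP => /negP v0; apply: nov; exists v.
apply/le_anti/andP; split.
  apply: ge_ereal_sup => _ [u /= u1 <-].
  by rewrite lee_fin (le_trans (norm_sub_proj_le u)).
have norm1 : `| `|v|^-1 *: v| = 1.
  by rewrite normrZ normfV normr_id mulVf // normr_eq0.
apply: ereal_sup_ubound; exists (`|v|^-1 *: v) => /=; first by rewrite norm1.
by rewrite proj_coinvariants ?subr0 ?norm1 //; exact: coinvariantsZ.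
Qed.

End WeakLimit.

Theorem theorem1 (R : realType) (G : topologicalGroupType)
    (E : completeNormedModType R) (pi : isometric_rep G E) (g : nat -> G) :
  locally_compact [set: G] ->
  class_O E ->
  tends_to_infinity g ->
  wot_cvg (fun n => pi (g n)) (proj_invariants pi) ->
  wot_cvg (fun n => pi (g n)^-1%g) (proj_invariants pi) ->
  BJ_orthogonal_sub (coinvariants pi) (invariants pi) /\
  (coinvariants pi != [set 0] ->
   opnorm (fun v => v - proj_invariants pi v) = 1%:E).
Proof.
move=> _ [_ _ opial] _ cvg_pi _; split; last exact: opnorm_sub_proj opial cvg_pi.
move=> v w cv _ iw _ l; apply: (norm_coinvariants_le _ _ _ _ _ opial cvg_pi) => //.
exact: invariantsZ.
Qed.
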